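(* A typical continuous function $f\in C[0,1]$ does not agree with any function of bounded variation on any set of Hausdorff dimension larger than $\frac{1}{2}$. That is, the set of those $f\in C[0,1]$ for which there are no function $g:[0,1]\to\mathbb{R}$ of bounded variation and set $H\subset[0,1]$ of Hausdorff dimension larger than $\frac12$ such that $f(x)=g(x)$ for every $x\in H$ is residual in $C[0,1]$.
   Context: $C[0,1]$ is the Banach space of continuous real-valued functions on $[0,1]$ with the supremum norm. A property holds for a typical continuous function if the set of $f\in C[0,1]$ having the property is residual (comeager), i.e. its complement is of first category in $C[0,1]$. A (not necessarily continuous) function $g:[0,1]\to\mathbb{R}$ is of bounded variation if $\sup\left\{\sum_{i=1}^m |g(x_i)-g(x_{i-1})| : m\in\mathbb{N},\ 0=x_0<x_1<\dots<x_m=1\right\}<\infty$. *)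

(* Defs.v *)
From HB Require Import structures.
From mathcomp Require Import all_boot all_order all_algebra.
From mathcomp Require Import all_classical all_reals all_analysis.

Set Implicit Arguments.
Unset Strict Implicit.
Unset Printing Implicit Defensive.

Import Order.TTheory GRing.Theory Num.Theory.
Import numFieldNormedType.Exports.

Local Open Scope classical_set_scope.
Local Open Scope ring_scope.

Definition unit_itv (R : realType) : set R := `[0, 1].
Arguments unit_itv : clear implicits.

(* The continuous functions on the subtype [0,1] of R. Both the norm and the
   topology come from the [Lmodule_isNormed] instance below, so that open sets
   of [C01 R] are those of the supremum norm [C01norm]. *)
Definition C01 (R : realType) : Type :=
  continuousType (unit_itv R) R.

HB.instance Definition _ (R : realType) := Choice.on (C01 R).

Section C01_normed.
Context {R : realType}.
Implicit Types f g h : C01 R.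

Definition mkC01 (u : unit_itv R -> R) (cu : continuous u) : C01 R :=
  mkcts cu.

Lemma C01P f g : (forall x, f x = g x) -> f = g.
Proof. by move=> fg; apply/continuousEP. Qed.

Lemma C01_cts f : continuous (f : unit_itv R -> R).
Proof. exact: cts_fun. Qed.

Definition C01zero : C01 R :=
  mkC01 (fun x => @cst_continuous _ R 0 x).
Definition C01opp f : C01 R :=
  mkC01 (fun x => cvgN (@C01_cts f x)).
Definition C01add f g : C01 R :=
  mkC01 (fun x => cvgD (@C01_cts f x) (@C01_cts g x)).
Definition C01scale (a : R) f : C01 R :=
  mkC01 (fun x => cvgM (cvg_cst a) (@C01_cts f x)).

Fact C01addA : associative C01add.
Proof. by move=> f g h; apply: C01P => x; exact: addrA. Qed.
Fact C01addC : commutative C01add.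
Proof. by move=> f g; apply: C01P => x; exact: addrC. Qed.
Fact C01add0 : left_id C01zero C01add.
Proof. by move=> f; apply: C01P => x; exact: add0r. Qed.
Fact C01addN : left_inverse C01zero C01opp C01add.
Proof. by move=> f; apply: C01P => x; exact: addNr. Qed.

HB.instance Definition _ :=
  GRing.isZmodule.Build (C01 R) C01addA C01addC C01add0 C01addN.

Fact C01scaleA (a b : R) f : C01scale a (C01scale b f) = C01scale (a * b) f.
Proof. by apply: C01P => x; exact: mulrA. Qed.
Fact C01scale1 : left_id 1 C01scale.
Proof. by move=> f; apply: C01P => x; exact: mul1r. Qed.
Fact C01scaleDr : right_distributive C01scale +%R.
Proof. by move=> a f g; apply: C01P => x; exact: mulrDr. Qed.
Fact C01scaleDl f : {morph C01scale^~ f : a b / a + b}.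
Proof. by move=> a b; apply: C01P => x; exact: mulrDl. Qed.

HB.instance Definition _ := GRing.Zmodule_isLmodule.Build R (C01 R)
  C01scaleA C01scale1 C01scaleDr C01scaleDl.

Definition C01norm f : R := sup (range (fun x => `|f x|)).

Lemma C01_has_sup f : has_sup (range (fun x => `|f x|)).
Proof.
have m0 : (0 : R) \in unit_itv R by rewrite inE /unit_itv/= in_itv/= lexx ler01.
split; first by exists `|f (SigSub m0)|; exists (SigSub m0).
have /subspace_valL_continuousP cf := @C01_cts f.
have /compact_bounded[M [_ /(_ (M + 1))]] :=
  continuous_compact cf (@segment_compact R 0 1).
rewrite ltrDl ltr01 => /(_ isT) Mf; exists (M + 1) => _ [x _ <-].
apply: Mf; exists (val x); first exact: set_valP.
by rewrite -[in RHS](@valLK _ _ 0 _ f) /sigL.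
Qed.

Lemma C01norm_ge f x : `|f x| <= C01norm f.
Proof. by apply: sup_upper_bound; [exact: C01_has_sup|exists x]. Qed.

Lemma C01norm_le f (M : R) : (forall x, `|f x| <= M) -> C01norm f <= M.
Proof.
by move=> fM; apply: ge_sup; [case: (C01_has_sup f)|move=> _ [x _ <-]].
Qed.

Fact C01normD f g : C01norm (f + g) <= C01norm f + C01norm g.
Proof.
apply: C01norm_le => x; apply: (le_trans (ler_normD (f x) (g x))).
by apply: lerD; exact: C01norm_ge.
Qed.

Fact C01normZ (a : R) f : C01norm (a *: f) = `|a| * C01norm f.
Proof.
have le b h : C01norm (b *: h) <= `|b| * C01norm h.
  apply: C01norm_le => x; rewrite [leLHS](normrM b (h x)).
  by rewrite ler_wpM2l// C01norm_ge.
apply/eqP; rewrite eq_le le/=.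
have [->|a0] := eqVneq a 0.
  rewrite normr0 mul0r; case: (C01_has_sup (0 *: f)) => -[_ [x _ _]] _.
  by apply: le_trans (C01norm_ge _ x).
by rewrite mulrC -ler_pdivlMr ?normr_gt0// mulrC -normfV -{1}(scalerK a0 f).
Qed.

Fact C01norm0_eq0 f : C01norm f = 0 -> f = 0.
Proof.
move=> f0; apply: C01P => x; apply/eqP; rewrite -normr_le0.
by apply: (le_trans (C01norm_ge f x)); rewrite f0.
Qed.

HB.instance Definition _ :=
  Lmodule_isNormed.Build R (C01 R) C01normD C01normZ C01norm0_eq0.

End C01_normed.

Section category.
Context {T : topologicalType}.
Implicit Types A : set T.

Definition nowhere_dense A := interior (closure A) = set0.

Definition first_category A :=
  exists2 F : (set T)^nat, (forall n, nowhere_dense (F n)) & A = \bigcup_n F n.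

Definition residual A := first_category (~` A).

End category.

Section hausdorff.
Context {R : realType}.
Implicit Types (A : set R) (s d : R).
Local Open Scope ereal_scope.

(* 0 is adjoined so that the diameter of the empty set is 0 and not -oo. *)
Definition diameter A : \bar R :=
  ereal_sup (0 |` [set `|x.1 - x.2|%:E | x in A `*` A]).

(* The empty set contributes 0 even when s = 0, although 0 `^ 0 = 1; thus the
   0-dimensional Hausdorff measure is the counting measure. *)
Definition hausdorff_gauge s A : \bar R :=
  if A == set0 then 0 else diameter A `^ s.

Definition hausdorff_premeasure s d A : \bar R :=
  ereal_inf [set \sum_(0 <= i <oo) hausdorff_gauge s (U i) | U in
    [set U : (set R)^nat |
      A `<=` \bigcup_i U i /\ forall i, diameter (U i) <= d%:E]].

Definition hausdorff_measure s A : \bar R :=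
  ereal_sup [set hausdorff_premeasure s d A | d in [set d | (0 < d)%R]].

Definition hausdorff_dim A : \bar R :=
  ereal_inf [set s%:E | s in [set s | (0 <= s)%R /\ hausdorff_measure s A = 0]].

End hausdorff.

(* Main.v *)
Require Import Defs.
From mathcomp Require Import all_boot all_order all_algebra.
From mathcomp Require Import all_classical all_reals all_analysis.
From mathcomp Require Import ring lra.

Set Implicit Arguments.
Unset Strict Implicit.
Unset Printing Implicit Defensive.

Import Order.TTheory GRing.Theory Num.Theory.
Import numFieldNormedType.Exports.
Local Open Scope classical_set_scope.
Local Open Scope ring_scope.

(** The covering argument.  Suppose that, for a huge number [k], the function
[f] is expanding on each interval [j/k, (j+1)/k]: it stretches distances by a
factor [L = a k], up to an error [1/k].  If [f] agrees on [H] with a function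
[g] of total variation [V], then [H] meets the [j]-th interval in a set of
diameter at most [l_j = (v_j + 1/k) / L], where [v_j] is the variation of [g]
on this interval.  So [H] is covered by [k] sets whose diameters add up to at
most [(V + 1) / (a k)].  Spreading this total evenly is the worst case, and it
gives [sum l_j ^ s] of the order of
[k ((V + 1) / (a k ^ 2)) ^ s = C k ^ (1 - 2 s)], which tends to [0] as [k]
grows exactly when [s > 1/2] (lemma [premeasure_le_of_steep]).

Such functions are typical because the expansion property is stable under
perturbations of size [1 / (2 k)] and easy to create: given [f] and [a > 0],
take [k] so large that [f] oscillates by less than [a] on intervals of length
[1/k], and interpolate linearly between the values [f (j/k) + a] for even [j]
and [f (j/k) - a] for odd [j].  The result is within [2 a] of [f], and its
slopes have absolute value at least [a k] (lemma [steep_dense]).  The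
functions that are expanding in this sense for no admissible [k] therefore
form a nowhere dense set, and countably many of these sets absorb all the
functions excluded by the theorem.

The amplitude [a] depends on the function which is approximated, while the
conclusion needs [k] to be large with respect to [a].  The set [steep N] below
requires directly what the covering argument uses, namely that
[k (n / (L k)) ^ (1/2 + 1/n)] is at most [1/n] for [n = N + 1]; the exponent
approaches [1/2] and the admitted variation [n] tends to infinity with [N]. *)

(** * Upper bounds for Hausdorff dimension *)

Section hausdorff_upper_bounds.
Context {R : realType}.
Implicit Types (A H : set R) (s d r : R).

Lemma diameter_le A r : 0 <= r ->
  (forall x y, A x -> A y -> `|x - y| <= r) -> (diameter A <= r%:E)%E.
Proof.
move=> r0 Ar; apply: ge_ereal_sup => _ [->|[[x y] [Ax Ay] <-]].
  by rewrite lee_fin.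
by rewrite lee_fin; exact: Ar.
Qed.

Lemma diameter_ge0 A : (0 <= diameter A)%E.
Proof. by apply: ereal_sup_ubound; left. Qed.

Lemma hausdorff_gauge_ge0 s A : (0 <= hausdorff_gauge s A)%E.
Proof. by rewrite /hausdorff_gauge; case: ifP => // _; exact: poweR_ge0. Qed.

Lemma hausdorff_gauge_le s A r : 0 < s -> 0 <= r ->
  (forall x y, A x -> A y -> `|x - y| <= r) ->
  (hausdorff_gauge s A <= (r `^ s)%:E)%E.
Proof.
move=> s0 r0 Ar; rewrite /hausdorff_gauge; case: ifP => _.
  by rewrite lee_fin powR_ge0.
rewrite -poweR_EFin; apply: gt0_ler_poweR; first exact: ltW.
- by rewrite in_itv/= diameter_ge0/= leey.
- by rewrite in_itv/= lee_fin r0 leey.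
- exact: diameter_le.
Qed.

(** A finite cover extends to a countable one by empty sets, whose gauge is
[0]. *)
Lemma hausdorff_premeasure_le A s d (k : nat) (U : nat -> set R)
    (l : nat -> R) : 0 < s -> 0 <= d ->
  A `<=` \bigcup_(j in [set j | (j < k)%N]) U j ->
  (forall j, (j < k)%N -> 0 <= l j) ->
  (forall j x y, (j < k)%N -> U j x -> U j y ->
    `|x - y| <= l j /\ `|x - y| <= d) ->
  (hausdorff_premeasure s d A <= (\sum_(0 <= j < k) l j `^ s)%:E)%E.
Proof.
move=> s0 d0 AU l0 Ul; pose V j := if (j < k)%N then U j else set0.
apply: ge_ereal_inf; exists (\sum_(0 <= i <oo) hausdorff_gauge s (V i))%E.
  exists V => //; split=> [x /AU[j /= jk Ujx]|j].
    by exists j => //; rewrite /V jk.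
  apply: diameter_le => // x y; rewrite /V; case: ifP => // jk.
  by move=> Ux /(Ul _ _ _ jk Ux)[].
rewrite (@nneseries_split _ _ _ k); last first.
  by move=> *; exact: hausdorff_gauge_ge0.
rewrite add0n [X in (_ + X)%E]eseries0; last first.
  by move=> i ki _; rewrite /V ltnNge ki /hausdorff_gauge eqxx.
rewrite adde0 -sumEFin big_nat_cond [leRHS]big_nat_cond.
apply: lee_sum => j; rewrite andbT => /andP[_ jk].
apply: hausdorff_gauge_le => //.
  exact: l0.
by move=> x y; rewrite /V jk => Ux /(Ul _ _ _ jk Ux)[].
Qed.

(** Only exponents close to [s0] matter, which leaves room for the assumption
[s <= 1] that the concavity argument of [sum_powR_le] requires. *)
Lemma hausdorff_dim_le A s0 : 0 <= s0 < 1 ->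
  (forall s d e, s0 < s <= 1 -> 0 < d -> 0 < e ->
    (hausdorff_premeasure s d A <= e%:E)%E) ->
  (hausdorff_dim A <= s0%:E)%E.
Proof.
move=> /andP[s00 s01] small; apply/lee_addgt0Pr => e e0.
pose s := Num.min (s0 + e) 1.
have ss : s0 < s <= 1 by rewrite /s lt_min ltrDl e0 s01 ge_min lexx orbT.
apply: (@le_trans _ _ s%:E); last by rewrite -EFinD lee_fin ge_min lexx.
apply: ereal_inf_lbound; exists s => //; split; first lra.
apply/eqP; rewrite eq_le; apply/andP; split.
  apply: ge_ereal_sup => _ [d /= d0 <-].
  by apply/lee_addgt0Pr => t t0; rewrite add0e; exact: small.
apply: le_ereal_sup_tmp; exists (hausdorff_premeasure s 1 A).
  by exists 1 => //=; exact: ltr01.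
apply: le_ereal_inf_tmp => _ [U _ <-]; apply: nneseries_ge0 => n _ _.
exact: hausdorff_gauge_ge0.
Qed.

End hausdorff_upper_bounds.

(** * Estimates on powers *)

Section powers.
Context {R : realType}.

(** A form of Jensen's inequality for the concave function [x ^ s], weaker by a
factor [2]: each term satisfies [l ^ s <= r ^ s (1 + l / r)], because
[(l / r) ^ s] is at most [1] if [l <= r] and at most [l / r] otherwise. *)
Lemma sum_powR_le (k : nat) (l : nat -> R) (r s : R) : 0 < r -> 0 < s <= 1 ->
  (forall j, (j < k)%N -> 0 <= l j) ->
  \sum_(0 <= j < k) l j <= k%:R * r ->
  \sum_(0 <= j < k) l j `^ s <= 2 * (k%:R * r `^ s).
Proof.
move=> r0 /andP[s0 s1] l0 lr.
have rs0 : 0 < r `^ s by exact: powR_gt0.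
apply: (@le_trans _ _ (\sum_(0 <= j < k) (r `^ s + r `^ s / r * l j))).
  rewrite big_nat_cond [leRHS]big_nat_cond.
  apply: ler_sum => j; rewrite andbT => /andP[_ /l0 lj0].
  have [ljr|rlj] := leP (l j) r.
    rewrite (@le_trans _ _ (r `^ s))//.
      by apply: ge0_ler_powR; rewrite ?nnegrE// ltW.
    by rewrite lerDl mulr_ge0// divr_ge0// ltW.
  rewrite -[X in X `^ s](divfK (lt0r_neq0 r0)) powRM ?divr_ge0 ?(ltW r0)//.
  rewrite mulrC (@le_trans _ _ (r `^ s * (l j / r)))//.
    by rewrite ler_pM2l// ler1_powR// ler_pdivlMr// mul1r ltW.
  by rewrite mulrCA mulrC -mulrA [r^-1 * _]mulrC mulrA lerDr ltW.
rewrite big_split/= sumr_const_nat subn0 -mulr_sumr.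
rewrite [2 * _]mulr_natl mulr2n mulr_natl lerD2l.
apply: (@le_trans _ _ (r `^ s / r * (k%:R * r))).
  by rewrite ler_wpM2l// divr_ge0// ltW.
by rewrite mulrCA divfK ?lt0r_neq0// mulr_natl.
Qed.

(** The left-hand side is [(n / a) ^ p k ^ (- 2 / n)] with [n = N + 1] and
[p = 1/2 + 1/n], since [1 - 2 p = - 2 / n]; it tends to [0] as [k] grows. *)
Lemma steep_parameters (a : R) (N : nat) : 0 < a -> exists K : nat,
  forall k, (K <= k)%N ->
  k%:R * (N.+1%:R / (a * k%:R * k%:R)) `^ (2^-1 + N.+1%:R^-1) <= N.+1%:R^-1.
Proof.
move=> a0; set n : R := N.+1%:R; set p := _ + _.
have n0 : 0 < n by rewrite ltr0n.
have c0 : 0 < n / a by rewrite divr_gt0.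
pose M := ((n / a) `^ p * n) `^ (n / 2).
exists (Num.bound M) => k Mk.
have M0 : 0 < M by rewrite powR_gt0// mulr_gt0// powR_gt0.
have {}Mk : M < k%:R.
  by apply: (lt_le_trans (archi_boundP (ltW M0))); rewrite ler_nat.
have k0 : 0 < k%:R :> R by exact: lt_trans Mk.
have {}Mk : (n / a) `^ p * n <= k%:R `^ (2 / n).
  have -> : (n / a) `^ p * n = M `^ (2 / n).
    rewrite -powRrM mulrA mulfVK ?pnatr_eq0// divff ?lt0r_neq0//.
    by rewrite powRr1// mulr_ge0 ?powR_ge0// ltW.
  by apply: ge0_ler_powR; rewrite ?nnegrE ?divr_ge0// ltW.
have -> : n / (a * k%:R * k%:R) = n / a * k%:R `^ (- 2%:R).
  by rewrite powR_invn ?ltW// -mulrA invfM expr2 mulrA.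
rewrite powRM ?powR_ge0 ?(ltW c0)// -powRrM.
have -> : - 2%:R * p = - 1 - 2 / n.
  by rewrite /p; field; exact: lt0r_neq0.
rewrite [_ `^ (-1 - _)]powRD; last by apply/implyP => _; exact: lt0r_neq0.
rewrite powR_inv1 ?(ltW k0)// powRN.
rewrite [_ * (k%:R^-1 * _)]mulrCA mulVKf ?lt0r_neq0//.
by rewrite ler_pdivrMr ?powR_gt0// [leRHS]mulrC ler_pdivlMr.
Qed.

End powers.

(** * Piecewise linear interpolation *)

Section interpolation.
Context {R : realType}.
Implicit Types (c : nat -> R) (k : nat) (t u : R).

(** The continuous function on the line that takes the value [c i] at each
integer [i <= k], is affine in between, and is constant outside [0, k].  As a
sum of truncated ramps it is continuous without any gluing. *)
Definition interp c k t : R :=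
  c 0%N + \sum_(0 <= i < k)
    (c i.+1 - c i) * Num.max 0 (Num.min 1 (t - i%:R)).

Lemma interpE c k j t : (j < k)%N -> j%:R <= t <= j.+1%:R ->
  interp c k t = c j + (c j.+1 - c j) * (t - j%:R).
Proof.
move=> jk; rewrite -natr1 => /andP[jt tj].
(* The ramps to the left of [j] are saturated and telescope; those to the right
   vanish. *)
rewrite /interp (@big_cat_nat _ _ _ j)//=; last exact: ltnW.
rewrite [X in _ + (_ + X)]big_ltn//.
rewrite (eq_big_nat _ _ (F2 := fun i => c i.+1 - c i)); last first.
  move=> i /andP[_ ij]; have : i.+1%:R <= j%:R :> R by rewrite ler_nat.
  rewrite -natr1 => ij'.
  by rewrite min_l ?max_r ?mulr1 ?ler01//; lra.
rewrite telescope_sumr// big_nat big1 => [|i /andP[ji _]]; last first.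
  have : j.+1%:R <= i%:R :> R by rewrite ler_nat.
  rewrite -natr1 => ji'.
  by rewrite min_r ?max_l ?mulr0//; lra.
rewrite min_r; last lra.
rewrite max_r; last lra.
by rewrite /=; ring.
Qed.

Lemma interp_continuous c k : continuous (interp c k).
Proof.
rewrite /interp => t; apply: cvgD; first exact: cvg_cst.
elim: k => [|k IH].
  under eq_fun do rewrite big_geq//.
  by rewrite big_geq//; exact: cvg_cst.
rewrite big_nat_recr//=; under eq_fun do rewrite big_nat_recr//=.
apply: cvgD; first exact: IH.
apply: cvgM; first exact: cvg_cst.
apply: (@continuous_max R R (fun=> 0) (fun t => Num.min 1 (t - k%:R)) t).
  exact: cvg_cst.
apply: (@continuous_min R R (fun=> 1) (fun t => t - k%:R) t).
  exact: cvg_cst.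
by apply: cvgB; [exact: cvg_id|exact: cvg_cst].
Qed.
End interpolation.

(** * Continuous functions on the unit interval and category *)

Section unit_interval_category.
Context {R : realType}.

(** The Heine-Cantor theorem, by a covering argument on the segment. *)
Lemma unit_itv_unif_continuous (f : C01 R) (e : R) : 0 < e ->
  exists2 d : R, 0 < d & forall x y : unit_itv R,
    `|set_val x - set_val y| < d -> `|f x - f y| < e.
Proof.
move=> e0.
pose P (d z : R) : Prop := forall x y : unit_itv R,
  `|z - set_val x| < d -> `|z - set_val y| < d -> `|f x - f y| < e.
have /compact_near_coveringP nc := @segment_compact R 0 1.
have step (z : R) : `[0, 1]%classic z ->
    \forall z' \near z & t \near 0^'+, P t z'.
  move=> z01; pose z' : unit_itv R := SigSub (mem_set z01).
  have : nbhs z' (f @^-1` ball (f z') (e / 2)).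
    by apply: (@C01_cts R f z'); apply: nbhsx_ballx; rewrite divr_gt0.
  move=> /nbhs_ballP [d /= d0 fd].
  have fz x : `|z - set_val x| < d -> `|f z' - f x| < e / 2.
    move=> zx; have : ball z' d x by [].
    by move=> /fd.
  exists (ball z (d / 2), [set t | t < d / 2]).
    split; first by apply: nbhsx_ballx; rewrite divr_gt0.
    by apply: nbhs_right_lt; rewrite divr_gt0.
  move=> [z1 t] /= [zz1 td] x y zx zy.
  move: zz1; rewrite /ball/= => zz1.
  have zxd : `|z - set_val x| < d.
    by have := ler_distD z1 z (set_val x); lra.
  have zyd : `|z - set_val y| < d.
    by have := ler_distD z1 z (set_val y); lra.
  have := fz _ zxd; have := fz _ zyd; rewrite (distrC _ (f x)).
  by have := ler_distD (f z') (f x) (f y); lra.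
have Pnear : \forall d \near (0 : R)^'+, `[0, 1] `<=` P d by exact: nc.
have /(@filter_ex _ _ (at_right_proper_filter (0 : R)))[d [Pd d0]] :
    \forall d \near (0 : R)^'+, `[0, 1] `<=` P d /\ 0 < d.
  by apply: filterI => //; exact: nbhs_right_gt.
exists d => // x y xy; apply: (Pd (set_val x)) => //; first exact: set_valP.
by rewrite subrr normr0.
Qed.

(** The hypothesis says that each [W N] contains a dense open set, so that its
complement is nowhere dense. *)
Lemma residual_of_dense_balls (T : normedModType R) (A : set T)
    (W : nat -> set T) :
  (\bigcap_N W N `<=` A) ->
  (forall N f e, 0 < e -> exists h d,
    [/\ `|f - h| < e, 0 < d & forall h', `|h - h'| < d -> W N h']) ->
  residual A.
Proof.
move=> WA dW; exists (fun N => ~` A `&` ~` W N).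
  move=> N; rewrite /nowhere_dense -subset0 => f.
  rewrite /interior => /nbhs_ballP[e /= e0 fe].
  have [h [d [fh d0 hd]]] := dW N f e e0.
  have : closure (~` A `&` ~` W N) h.
    by apply: fe; rewrite -ball_normE.
  move=> /(_ _ (nbhsx_ballx h d d0))[h' [[_ nW]]].
  by rewrite -ball_normE => /hd.
apply/seteqP; split=> [f nAf|f [N _ []//]].
apply: contrapT => nf; apply/nAf/WA => N _; apply: contrapT => nW.
by apply: nf; exists N.
Qed.
End unit_interval_category.

(** * Functions that expand all small intervals *)

Section steep.
Context {R : realType}.

(** The interval [j/k, (j+1)/k]. *)
Definition cell (k j : nat) : set R := [set x | j%:R <= k%:R * x <= j.+1%:R].

(** The numerical condition is the smallness required of the cover which the
expansion condition produces.  The slack [k ^ (-1)] makes the expansion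
condition survive small uniform perturbations; added up over the [k] cells, it
costs no more than one unit of variation. *)
Definition steep (N : nat) : set (C01 R) := [set f | exists (k : nat) (L : R),
  [/\ (N < k)%N, 0 < L,
    k%:R * (N.+1%:R / (L * k%:R)) `^ (2^-1 + N.+1%:R^-1) <= N.+1%:R^-1 &
    forall j (x y : unit_itv R), (j < k)%N ->
      cell k j (set_val x) -> cell k j (set_val y) ->
      L * `|set_val x - set_val y| <= `|f x - f y| + k%:R^-1]].

Lemma cell_cover (k : nat) (x : R) : (0 < k)%N -> unit_itv R x ->
  exists2 j, (j < k)%N & cell k j x.
Proof.
move=> k0; rewrite /unit_itv/= in_itv/= => /andP[x0 x1].
have k0' : 0 < k%:R :> R by rewrite ltr0n.
have kx0 : 0 <= k%:R * x by rewrite mulr_ge0.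
have kxk : k%:R * x <= k%:R by rewrite ler_piMr// ltW.
have /andP[t0 t1] := truncn_itv kx0.
have [tk|kt] := ltnP (Num.truncn (k%:R * x)) k.
  by exists (Num.truncn (k%:R * x)) => //; rewrite /cell/= t0 ltW.
(* The remaining case is the right endpoint [x = 1]. *)
exists k.-1; first by rewrite prednK.
rewrite /cell/= prednK// kxk andbT (le_trans _ t0)// ler_nat.
exact: leq_trans (leq_pred _) kt.
Qed.

Lemma cell_dist (k j : nat) (x y : R) : (0 < k)%N ->
  cell k j x -> cell k j y -> `|x - y| <= k%:R^-1.
Proof.
move=> k0; rewrite /cell/= -natr1 => /andP[x0 x1] /andP[y0 y1].
have k0' : 0 < k%:R :> R by rewrite ltr0n.
rewrite -[leRHS]mul1r ler_pdivlMr// -[X in _ * X](gtr0_norm k0') -normrM mulrC.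
by rewrite mulrBr ler_norml; apply/andP; split; lra.
Qed.

Lemma interp_C01 (c : nat -> R) (k : nat) :
  continuous (fun x : unit_itv R => interp c k (k%:R * set_val x)).
Proof.
move=> x.
have c1 : {for x, continuous (fun x : unit_itv R => k%:R * set_val x)}.
  apply: (@continuousM _ _ (fun=> k%:R) (fun x : unit_itv R => set_val x)).
    exact: cst_continuous.
  exact: (@initial_continuous _ _ (@set_val R (unit_itv R))).
exact: (@continuous_comp _ _ _ (fun x : unit_itv R => k%:R * set_val x)
  (interp c k) x c1 (@interp_continuous _ c k _)).
Qed.

(** The approximating function interpolates the nodes of [f] displaced
alternately by [a] and [- a]: consecutive nodes differ by [2 a] up to the
oscillation of [f], which is less than [a], so all slopes exceed [a k] in
absolute value. *)
Lemma steep_dense N (f : C01 R) (e : R) : 0 < e -> exists h d,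
  [/\ `|f - h| < e, 0 < d & forall h', `|h - h'| < d -> steep N h'].
Proof.
move=> e0; pose a := e / 3.
have a0 : 0 < a by rewrite divr_gt0.
have [d d0 fd] := unit_itv_unif_continuous f a0.
have [K Kk] := steep_parameters N a0.
pose k := maxn (maxn K N.+1) (Num.bound d^-1).
have KK : (K <= k)%N by rewrite /k !leq_max leqnn.
have Nk : (N < k)%N by rewrite /k !leq_max leqnn orbT.
have k0 : (0 < k)%N by exact: leq_ltn_trans Nk.
have k0' : 0 < k%:R :> R by rewrite ltr0n.
have kd : k%:R^-1 < d.
  rewrite -[ltRHS]invrK ltf_pV2 ?posrE ?invr_gt0//.
  have d0' : 0 < d^-1 by rewrite invr_gt0.
  apply: (lt_le_trans (archi_boundP (ltW d0'))).
  by rewrite ler_nat leq_max leqnn orbT.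
have z01 : (0 : R) \in unit_itv R.
  by rewrite inE /unit_itv/= in_itv/= lexx ler01.
pose node (j : nat) : unit_itv R := insubd (SigSub z01) (j%:R / k%:R).
have nodeE j : (j <= k)%N -> set_val (node j) = j%:R / k%:R.
  move=> jk; rewrite set_valE insubdK//= inE /unit_itv/= in_itv/=.
  by rewrite divr_ge0//= ler_pdivrMr// mul1r ler_nat.
pose c j : R := f (node j) + (-1) ^+ j * a.
have node_cell j i : (j < k)%N ->
    i = j \/ i = j.+1 -> cell k j (set_val (node i)).
  move=> jk [->|->]; rewrite nodeE// 1?ltnW// /cell/=;
  by rewrite mulrC divfK ?lt0r_neq0// !ler_nat leqnSn leqnn.
have fnode j i (x : unit_itv R) : (j < k)%N -> i = j \/ i = j.+1 ->
    cell k j (set_val x) -> `|f (node i) - f x| < a.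
  move=> jk ij xj; apply: fd; apply: le_lt_trans kd.
  by apply: cell_dist xj => //; exact: node_cell.
have sign j : (-1) ^+ j = 1 :> R \/ (-1) ^+ j = -1 :> R.
  by rewrite -signr_odd; case: odd; [right|left].
have cS j : (j < k)%N -> a <= `|c j.+1 - c j|.
  move=> jk.
  have := fnode j j.+1 (node j) jk (or_intror erefl)
    (node_cell _ _ jk (or_introl erefl)).
  rewrite /c exprS ltr_norml => /andP[fl fr]; rewrite ler_normr; apply/orP.
  by case: (sign j) => ->; [right|left]; lra.
pose h : C01 R := mkC01 (@interp_C01 c k).
have hE j (x : unit_itv R) : (j < k)%N -> cell k j (set_val x) ->
    h x = c j + (c j.+1 - c j) * (k%:R * set_val x - j%:R).
  by move=> jk xj; exact: interpE.
(* Moving [h] by less than [1 / (2 k)] changes each increment by at most the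
   slack [1 / k]. *)
exists h, (2 * k%:R)^-1; split.
- apply: (@le_lt_trans _ _ (2 * a)); last by rewrite /a; lra.
  apply: C01norm_le => x.
  have [j jk xj] := cell_cover k0 (set_valP x).
  change (`|f x - h x| <= 2 * a); rewrite (hE j)//.
  have := fnode _ _ _ jk (or_introl erefl) xj.
  have := fnode _ _ _ jk (or_intror erefl) xj.
  have /andP[xl] : j%:R <= k%:R * set_val x <= j.+1%:R := xj.
  rewrite -natr1 => xr; set t := k%:R * _ - _.
  have t0 : 0 <= t by rewrite subr_ge0.
  have t1 : 0 <= 1 - t by rewrite /t; lra.
  rewrite !ltr_norml => /andP[l1 r1] /andP[l2 r2].
  have cj i : - a < f (node i) - f x -> f (node i) - f x < a ->
      - (2 * a) <= f x - c i <= 2 * a.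
    by move=> l r; rewrite /c; case: (sign i) => ->; lra.
  have /andP[{}l1 {}r1] := cj _ l1 r1; have /andP[{}l2 {}r2] := cj _ l2 r2.
  (* [h x] is a convex combination of two nodes within [2 a] of [f x]. *)
  rewrite ler_norml; apply/andP; split; nra.
- by rewrite invr_gt0 mulr_gt0.
move=> h' hh'; exists k, (a * k%:R); split => //.
- by rewrite mulr_gt0.
- exact: Kk.
move=> j x y jk xj yj.
have hx (z : unit_itv R) : `|h z - h' z| <= (2 * k%:R)^-1.
  by apply: le_trans (ltW hh'); exact: (C01norm_ge (h - h')).
have : a * k%:R * `|set_val x - set_val y| <= `|h x - h y|.
  rewrite (hE j x)// (hE j y)//.
  have -> : c j + (c j.+1 - c j) * (k%:R * set_val x - j%:R) -
    (c j + (c j.+1 - c j) * (k%:R * set_val y - j%:R)) =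
    (c j.+1 - c j) * k%:R * (set_val x - set_val y) by ring.
  rewrite !normrM (gtr0_norm k0'); apply: ler_wpM2r => //.
  by apply: ler_wpM2r; [exact: ltW|exact: cS].
move=> /le_trans; apply.
have -> : k%:R^-1 = (2 * k%:R)^-1 + (2 * k%:R)^-1 :> R.
  by field; exact: lt0r_neq0.
have := hx x; have := hx y; rewrite (distrC (h y)).
have := ler_distD (h' x) (h x) (h y); have := ler_distD (h' y) (h' x) (h y).
lra.
Qed.

(** A primitive form of Jordan decomposition: [G] is the variation of [g] up to
the given point. *)
Lemma bounded_variation_dominated (g : R -> R) : bounded_variation 0 1 g ->
  exists G : R -> R, forall x y, 0 <= x -> x <= y -> y <= 1 ->
    `|g y - g x| <= G y - G x.
Proof.
move=> /(bounded_variationP _ ler01) gfin.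
exists (fun t => fine (total_variation 0 t g)) => x y x0 xy y1.
have y0 : 0 <= y by exact: le_trans xy.
move: gfin; rewrite (total_variationD g y0 y1) (total_variationD g x0 xy).
rewrite !fin_numD => /andP[/andP[fx fxy] _].
rewrite fineD// addrAC subrr add0r -lee_fin fineK//.
exact: total_variation_ge.
Qed.

(** The traces of [H] on the cells form the required cover. *)
Lemma premeasure_le_of_steep (f : C01 R) (g : R -> R) (H : set R) (s d e : R) :
  (forall N, steep N f) -> bounded_variation 0 1 g -> H `<=` unit_itv R ->
  (forall x : unit_itv R, H (set_val x) -> f x = g (set_val x)) ->
  2^-1 < s <= 1 -> 0 < d -> 0 < e ->
  (hausdorff_premeasure s d H <= e%:E)%E.
Proof.
move=> f_steep /bounded_variation_dominated[G gG] H01 fg /andP[s2 s1] d0 e0.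
pose V := G 1 - G 0.
have V0 : 0 <= V by apply: (le_trans _ (gG 0 1 _ _ _)).
have q0 : 0 < s - 2^-1 by lra.
have [N] : exists N : nat, [/\ V + 1 <= N.+1%:R, N.+1%:R^-1 <= d,
    2 * N.+1%:R^-1 <= e & N.+1%:R^-1 <= s - 2^-1].
  have d0' : 0 < d^-1 by rewrite invr_gt0.
  have e0' : 0 < 2 / e by rewrite divr_gt0.
  have q0' : 0 < (s - 2^-1)^-1 by rewrite invr_gt0.
  have [N MN] : exists N : nat, V + 1 + d^-1 + 2 / e + (s - 2^-1)^-1 < N.+1%:R.
    exists (Num.truncn (V + 1 + d^-1 + 2 / e + (s - 2^-1)^-1)).
    exact: truncnS_gt.
  exists N; have n0 : 0 < N.+1%:R :> R by rewrite ltr0n.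
  have inv (u : R) : 0 < u -> u^-1 <= N.+1%:R -> N.+1%:R^-1 <= u.
    by move=> u0 uN; rewrite -[leRHS]invrK lef_pV2// posrE// invr_gt0.
  move: (N.+1%:R : R) MN n0 inv => n MN n0 inv.
  split.
  - by lra.
  - by apply: inv => //; lra.
  - by rewrite ler_pdivrMr// mulrC -ler_pdivrMr//; lra.
  - by apply: inv => //; lra.
move=> [VN Nd Ne Ns].
have [k [L [Nk L0 kL fL]]] := f_steep N.
set n : R := N.+1%:R in VN Nd Ne Ns kL.
have n0 : 0 < n by rewrite ltr0n.
have k0 : (0 < k)%N by exact: leq_ltn_trans Nk.
have k0' : 0 < k%:R :> R by rewrite ltr0n.
have kn : k%:R^-1 <= n^-1 by rewrite lef_pV2 ?posrE// ler_nat.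
set p := 2^-1 + n^-1 in kL; set r := n / (L * k%:R) in kL.
have r0 : 0 < r by rewrite divr_gt0// mulr_gt0.
have p0 : 0 < p by rewrite addr_gt0 ?invr_gt0.
have ps : p <= s by rewrite /p addrC -lerBrDr.
(* [r <= 1] lets the exponent [p] be raised to [s]; it is forced by the
   smallness of [k r ^ p]. *)
have r1 : r <= 1.
  rewrite leNgt; apply/negP => r1.
  have rp : 1 < r `^ p.
    rewrite -[ltLHS](congr1 (@^~ p) (@powR1 R)); apply: gt0_ltr_powR => //;
      rewrite nnegrE; lra.
  suff : n^-1 < k%:R * r `^ p by rewrite ltNge kL.
  have k1 : 1 <= k%:R :> R by rewrite ler1n.
  have n1 : n^-1 <= 1 by rewrite invf_le1// ler1n.
  apply: (le_lt_trans n1); apply: (lt_le_trans rp).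
  by rewrite ler_peMl// ltW ?powR_gt0.
(* [l j] bounds the diameter of the trace of [H] on the [j]-th cell. *)
pose t j : R := j%:R / k%:R.
pose l j : R := (G (t j.+1) - G (t j) + k%:R^-1) / L.
have t01 j : (j <= k)%N -> 0 <= t j /\ t j <= 1.
  by move=> jk; rewrite /t divr_ge0//= ler_pdivrMr// mul1r ler_nat.
have tS j : t j <= t j.+1.
  by rewrite /t ler_wpM2r ?invr_ge0 ?(ltW k0')// ler_nat.
have cellP j x : cell k j x -> t j <= x /\ x <= t j.+1.
  by rewrite /cell/= /t ler_pdivrMr// ler_pdivlMr// mulrC => /andP[].
have Gmono x y : 0 <= x -> x <= y -> y <= 1 -> G x <= G y.
  by move=> x0 xy y1; rewrite -subr_ge0 (le_trans _ (gG _ _ x0 xy y1)).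
have gcell j x y : (j < k)%N -> cell k j x -> cell k j y -> x <= y ->
    `|g y - g x| <= G (t j.+1) - G (t j).
  move=> jk /cellP[x0 x1] /cellP[y0 y1] xy.
  have [tj0 _] := t01 _ (ltnW jk); have [_ tj1] := t01 _ jk.
  have x0' := le_trans tj0 x0; have y1' := le_trans y1 tj1.
  apply: (le_trans (gG _ _ x0' xy y1')).
  have := Gmono _ _ tj0 x0 (le_trans xy y1').
  by have := Gmono _ _ (le_trans x0' xy) y1 tj1; lra.
have l_ge0 j : (j < k)%N -> 0 <= l j.
  move=> jk; rewrite divr_ge0 ?(ltW L0)// addr_ge0 ?invr_ge0 ?(ltW k0')//.
  have [tj0 _] := t01 _ (ltnW jk); have [_ tj1] := t01 _ jk.
  by rewrite subr_ge0 Gmono.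
apply: (@le_trans _ _ (\sum_(0 <= j < k) l j `^ s)%:E).
  apply: (@hausdorff_premeasure_le _ _ _ _ _ (fun j => H `&` cell k j)).
  - by lra.
  - exact: ltW.
  - by move=> x Hx; have [j jk xj] := cell_cover k0 (H01 _ Hx); exists j.
  - exact: l_ge0.
  - move=> j x y jk [Hx xj] [Hy yj]; split; last first.
      exact: (le_trans (cell_dist k0 xj yj) (le_trans kn Nd)).
    pose x' : unit_itv R := SigSub (mem_set (H01 _ Hx)).
    pose y' : unit_itv R := SigSub (mem_set (H01 _ Hy)).
    rewrite ler_pdivlMr// mulrC (le_trans (fL j x' y' jk xj yj))// lerD2r.
    rewrite (fg x' Hx) (fg y' Hy).
    have [xy|/ltW yx] := leP x y; last exact: (gcell j y x).
    by rewrite distrC; exact: (gcell j x y).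
rewrite lee_fin; apply: (@le_trans _ _ (2 * (k%:R * r `^ s))).
  apply: sum_powR_le => //; first by rewrite s1 andbT; lra.
  rewrite /l -mulr_suml big_split/= telescope_sumr// sumr_const_nat subn0.
  rewrite /t mul0r divff ?lt0r_neq0// -[_ *+ _]mulr_natr mulVf ?lt0r_neq0//.
  have -> : k%:R * r = n / L by rewrite /r; field; rewrite !lt0r_neq0.
  by rewrite ler_wpM2r// invr_ge0 ltW.
apply: (le_trans _ Ne); rewrite ler_pM2l//; apply: le_trans kL.
by rewrite ler_wpM2l ?(ltW k0')// ger_powR// r0.
Qed.

End steep.

(** * Typical continuous functions *)

Theorem theorem0p5 (R : realType) :
  residual [set f : C01 R | ~ exists (g : R -> R) (H : set R),
    [/\ bounded_variation 0 1 g,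
        H `<=` unit_itv R,
        ((2^-1)%:E < hausdorff_dim H)%E &
        forall x : unit_itv R, H (set_val x) -> f x = g (set_val x)]].
Proof.
apply: (@residual_of_dense_balls R (C01 R) _ (@steep R)) => [f f_steep|].
  move=> [g [H [gBV H01 + fg]]]; rewrite ltNge => /negP; apply.
  apply: hausdorff_dim_le => [|s d e s01 d0 e0].
    by rewrite invr_ge0 ler0n invf_lt1// ltr1n.
  by apply: (premeasure_le_of_steep (fun N => f_steep N I) gBV H01 fg).
exact: steep_dense.
Qed.
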